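(* Let $\varepsilon>0$, $1<p<\infty$, $q:=\frac{p}{p-1}$, and let $Q\subset\mathbb{R}^d$ be open. There exists a unique linear isometric isomorphism $\mathcal{T}_{\varepsilon}: L^p(\Omega\times Q)\to L^p(\Omega\times Q)$ such that for all $u\in L^p(\Omega)\overset{a}{\otimes}L^p(Q)$, $$(\mathcal{T}_{\varepsilon}u)(\omega,x)=u(\tau_{-\frac{x}{\varepsilon}}\omega,x)\qquad\text{a.e. in }\Omega\times Q.$$ Moreover, its adjoint is the unique linear isometric isomorphism $\mathcal{T}_{\varepsilon}^{*}:L^q(\Omega\times Q)\to L^q(\Omega\times Q)$ that satisfies $(\mathcal{T}_{\varepsilon}^{*}u)(\omega,x)=u(\tau_{\frac{x}{\varepsilon}}\omega,x)$ a.e. in $\Omega\times Q$ for all $u\in L^q(\Omega)\overset{a}{\otimes}L^q(Q)$.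
   Context: Standing assumption: $(\Omega,\mathcal{F},P)$ is a probability space with countably generated $\sigma$-algebra, and $\tau=\{\tau_x\}_{x\in\mathbb{R}^d}$ is a group of measurable bijections $\tau_x:\Omega\to\Omega$ such that (i) $\tau_0=\mathrm{Id}$ and $\tau_{x+y}=\tau_x\circ\tau_y$ for all $x,y\in\mathbb{R}^d$; (ii) $P(\tau_xA)=P(A)$ for all $A\in\mathcal{F}$, $x\in\mathbb{R}^d$; (iii) $(\omega,x)\mapsto\tau_x\omega$ is $\mathcal{F}\otimes\mathcal{L}$-measurable, where $\mathcal{L}$ is the Lebesgue $\sigma$-algebra on $\mathbb{R}^d$. Notation: $X\overset{a}{\otimes}Y:=\{\sum_{i=1}^n\varphi_i\eta_i:\varphi_i\in X,\ \eta_i\in Y,\ n\in\mathbb{N}\}$ is the algebraic tensor product, viewed as functions $(\omega,x)\mapsto\sum_i\varphi_i(\omega)\eta_i(x)$. $L^p(\Omega)\overset{a}{\otimes}L^p(Q)$ is dense in $L^p(\Omega\times Q)$. The dual of $L^p(\Omega\times Q)$ is identified with $L^q(\Omega\times Q)$. *)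

(* Defs.v *)
From HB Require Import structures.
From mathcomp Require Import all_boot all_order all_algebra.
From mathcomp Require Import all_classical all_reals all_analysis.
From mathcomp Require Import measurable_realfun ess_sup_inf.
From mathcomp Require Import lra.
Set Implicit Arguments.
Unset Strict Implicit.
Unset Printing Implicit Defensive.
Import Order.TTheory GRing.Theory Num.Theory.
Import numFieldNormedType.Exports.
Local Open Scope classical_set_scope.
Local Open Scope ring_scope.

Section lebesgue_outer_measure.
Context (R : realType) (d : nat).
Implicit Types (c : 'rV[R]_d * 'rV[R]_d) (X : set 'rV[R]_d).

(* [c] is the pair of the lower and upper corners of a closed box. *)
Definition box c : set 'rV[R]_d :=
  [set x | forall i, c.1 ord0 i <= x ord0 i <= c.2 ord0 i].

Definition box_volume c : R :=
  \prod_(i < d) Num.max 0 (c.2 ord0 i - c.1 ord0 i).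

(* Infimum of the total volume over countable covers of [X] by closed boxes.
   The index set [I] may be finite or empty, which matters when [d = 0]: the
   only box is then the whole space and has volume 1. *)
Definition lebesgue_outer X : \bar R :=
  ereal_inf [set v | exists (I : set nat) (c : nat -> 'rV[R]_d * 'rV[R]_d),
    X `<=` \bigcup_(k in I) box (c k) /\
    v = (\esum_(k in I) (box_volume (c k))%:E)%E].

Lemma box_volume_ge0 c : 0 <= box_volume c.
Proof. by apply: prodr_ge0 => i _; rewrite le_max lexx. Qed.

Let lebesgue_outer0 : lebesgue_outer set0 = 0%E.
Proof.
apply/eqP; rewrite eq_le; apply/andP; split.
  apply: ereal_inf_lbound; exists set0, (fun=> (0, 0)); split => //.
  by rewrite esum_set0.
apply: le_ereal_inf_tmp => v [I [c [_ ->]]].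
by apply: esum_ge0 => k _; rewrite lee_fin box_volume_ge0.
Qed.

Let lebesgue_outer_ge0 X : (0 <= lebesgue_outer X)%E.
Proof.
apply: le_ereal_inf_tmp => v [I [c [_ ->]]].
by apply: esum_ge0 => k _; rewrite lee_fin box_volume_ge0.
Qed.

Let le_lebesgue_outer : {homo lebesgue_outer : A B / A `<=` B >-> (A <= B)%E}.
Proof.
move=> A B AB; apply: ereal_inf_le_tmp => v [I [c [BI ->]]].
by exists I, c; split => //; exact: subset_trans BI.
Qed.

Let lebesgue_outer_sigma_subadditive : sigma_subadditive lebesgue_outer.
Proof.
move=> A; have [[i ioo]|] := pselect (exists i, lebesgue_outer (A i) = +oo%E).
  rewrite (eseries_pinfty _ _ ioo) ?leey// => n _.
  by rewrite -ltNye (lt_le_trans _ (lebesgue_outer_ge0 _)).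
rewrite -forallNE => Aoo.
apply/lee_addgt0Pr => e e0.
rewrite (le_trans _ (epsilon_trick _ _ (ltW e0)))//.
pose P n (G : set nat * (nat -> 'rV[R]_d * 'rV[R]_d)) :=
  A n `<=` \bigcup_(k in G.1) box (G.2 k) /\
  (\esum_(k in G.1) (box_volume (G.2 k))%:E
    <= lebesgue_outer (A n) + (e / (2 ^ n.+1)%:R)%:E)%E.
have [G PG] : {G & forall n, P n (G n)}.
  apply: (@choice _ _ P) => n.
  have fA : lebesgue_outer (A n) \is a fin_num.
    by rewrite ge0_fin_numE// lt_neqAle leey andbT; apply/eqP/Aoo.
  have en0 : 0 < e / (2 ^ n.+1)%:R by rewrite divr_gt0// ltr0n expn_gt0.
  have [v [I [c [AI ->]]] /ltW vA] := lb_ereal_inf_adherent en0 fA.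
  by exists (I, c).
have /card_esym/ppcard_eqP[f] := card_nat2.
pose J := [set k | (G (f k).1).1 (f k).2].
apply: (@le_trans _ _
    (\esum_(k in J) (box_volume ((G (f k).1).2 (f k).2))%:E)%E).
  apply: ereal_inf_lbound; exists J, (fun k => (G (f k).1).2 (f k).2).
  split=> // x [n _ /(PG n).1[m nm xm]].
  have fnm : f (f^-1%FUN (n, m)) = (n, m) by rewrite invK ?inE.
  by exists (f^-1%FUN (n, m)); rewrite /J/= fnm.
pose g (x : nat * nat) : \bar R := (box_volume ((G x.1).2 x.2))%:E.
have g0 x : (0 <= g x)%E by rewrite lee_fin box_volume_ge0.
rewrite -(@reindex_esum R _ _ J [set x | (G x.1).1 x.2] f g) /=; last first.
  split.
  - by move=> k.
  - by move=> x y _ _; apply: inj; rewrite inE.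
  - move=> [n m] nm; exists (f^-1%FUN (n, m)); rewrite /J/= invK ?inE//.
have -> : [set x | (G x.1).1 x.2] = [set: nat] `*`` (fun n => (G n).1).
  by apply/seteqP; split => [[n m]//= |[n m] []].
rewrite -(@esum_esum R _ _ setT (fun n => (G n).1) (fun n m => g (n, m)))//.
rewrite -nneseries_esumT; last by move=> n; apply: esum_ge0.
apply: lee_nneseries => [n _ _|n _]; first exact: esum_ge0.
exact: (PG n).2.
Qed.

HB.instance Definition _ := isOuterMeasure.Build R 'rV[R]_d lebesgue_outer
  lebesgue_outer0 lebesgue_outer_ge0 le_lebesgue_outer
  lebesgue_outer_sigma_subadditive.

End lebesgue_outer_measure.

(* R^d with its Lebesgue sigma-algebra, i.e. the sets that are Caratheodory
   measurable for the Lebesgue outer measure. *)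
Definition Leb (R : realType) (d : nat) : measurableType _ :=
  caratheodory_type (@lebesgue_outer R d).

Section lebesgue_measure_Rd.
Context (R : realType) (d : nat).

Definition lebesgue_Rd : set (Leb R d) -> \bar R := @lebesgue_outer R d.

Let lebesgue_Rd0 : lebesgue_Rd set0 = 0%E.
Proof. exact: outer_measure0. Qed.

Let lebesgue_Rd_ge0 A : (0 <= lebesgue_Rd A)%E.
Proof. exact: outer_measure_ge0. Qed.

Let lebesgue_Rd_sigma_additive : semi_sigma_additive lebesgue_Rd.
Proof. exact: (@caratheodory_measure_sigma_additive R _ (@lebesgue_outer R d)). Qed.

HB.instance Definition _ := isMeasure.Build _ _ _ lebesgue_Rd
  lebesgue_Rd0 lebesgue_Rd_ge0 lebesgue_Rd_sigma_additive.

Lemma lebesgue_Rd_halfspace (i : 'I_d) (t : R) :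
  measurable ([set x : 'rV[R]_d | x ord0 i <= t] : set (Leb R d)).
Proof.
apply: le_caratheodory_measurable => X; set H := [set x | _].
apply: le_ereal_inf_tmp => v [I [c [XI ->]]].
pose up (y : 'rV[R]_d) (s : R) : 'rV[R]_d :=
  \row_j (if j == i then s else y ord0 j).
pose cl k := ((c k).1, up (c k).2 (Num.min ((c k).2 ord0 i) t)).
pose cr k := (up (c k).1 (Num.max ((c k).1 ord0 i) t), (c k).2).
have volE k : box_volume (c k) = box_volume (cl k) + box_volume (cr k).
  rewrite /box_volume !(bigD1 i (P := xpredT))//=.
  rewrite [in X in _ = X + _](eq_bigr
    (fun j => Num.max 0 ((c k).2 ord0 j - (c k).1 ord0 j))); last first.
    by move=> j /negbTE ji; rewrite mxE ji.
  rewrite [in X in _ = _ + X](eq_bigr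
    (fun j => Num.max 0 ((c k).2 ord0 j - (c k).1 ord0 j))); last first.
    by move=> j /negbTE ji; rewrite mxE ji.
  rewrite -mulrDl !mxE eqxx; congr (_ * _).
  set a := (c k).1 ord0 i; set b := (c k).2 ord0 i.
  clear; rewrite !maxEle !minEle.
  by do ![case: ifPn]; rewrite -?ltNge => *; lra.
apply: (@le_trans _ _ (\esum_(k in I) (box_volume (cl k))%:E +
                       \esum_(k in I) (box_volume (cr k))%:E)%E); last first.
  rewrite -esumD; try by move=> k _; rewrite lee_fin box_volume_ge0.
  by apply: le_esum => k _; rewrite -EFinD -volE.
apply: leeD; apply: ereal_inf_lbound => /=.
- exists I, cl; split=> // x [/XI[k Ik xk] Hx]; exists k => // j.
  rewrite /cl/= mxE; case: eqP => [->|_]; last exact: xk.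
  by have /andP[-> xb] := xk i; rewrite le_min xb Hx.
- exists I, cr; split=> // x [/XI[k Ik xk]] /negP; rewrite -ltNge => Hx; exists k => // j.
  rewrite /cr/= mxE; case: eqP => [->|_]; last exact: xk.
  by have /andP[ax ->] := xk i; rewrite ge_max ax (ltW Hx).
Qed.

Lemma lebesgue_Rd_halfspaceN (i : 'I_d) (t : R) :
  measurable ([set x : 'rV[R]_d | t <= x ord0 i] : set (Leb R d)).
Proof.
rewrite (_ : [set x | _] =
    \bigcap_n ~` [set x : 'rV[R]_d | x ord0 i <= t - n.+1%:R^-1]).
  apply: bigcapT_measurable => n; apply: measurableC.
  exact: lebesgue_Rd_halfspace.
apply/seteqP; split => [x /= tx n _ /=|x /= xt].
  by apply/negP; rewrite -ltNge (lt_le_trans _ tx)// gtrBl invr_gt0.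
rewrite leNgt; apply/negP => /ltr_add_invr[n xn].
by have /= := xt n Logic.I; rewrite lerBrDr => /negP; rewrite -ltNge ltNge (ltW xn).
Qed.

Lemma lebesgue_Rd_measurable_box c : measurable (box c : set (Leb R d)).
Proof.
rewrite (_ : box c = \bigcap_(i in [set: 'I_d])
    ([set x : 'rV[R]_d | c.1 ord0 i <= x ord0 i] `&`
     [set x : 'rV[R]_d | x ord0 i <= c.2 ord0 i])).
  apply: fin_bigcap_measurable => // i _; apply: measurableI.
    exact: lebesgue_Rd_halfspaceN.
  exact: lebesgue_Rd_halfspace.
apply/seteqP; split => [x xc i _|x xc i]; first exact/andP.
exact/andP/(xc i Logic.I).
Qed.

Lemma lebesgue_Rd_measurable_open (Q : set 'rV[R]_d) :
  open Q -> measurable (Q : set (Leb R d)).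
Proof.
move=> oQ.
pose B (q : 'rV[rat]_d * 'rV[rat]_d) : 'rV[R]_d * 'rV[R]_d :=
  (map_mx ratr q.1, map_mx ratr q.2).
rewrite (_ : Q = \bigcup_(q in [set q | box (B q) `<=` Q]) box (B q)).
  rewrite bigcup_mkcond; apply: countable_bigcupT_measurable => [|q].
    exact: countableP.
  by case: ifP => // _; exact: lebesgue_Rd_measurable_box.
apply/seteqP; split => [x Qx|x [q qQ /qQ]//].
have /nbhs_ballP[e /= e0 xeQ] : nbhs x Q by exact: open_nbhs_nbhs.
have rat_between (a b : R) : a < b -> {q : rat | a < ratr q < b}.
  by move=> ab; have /cid[q qab] := rat_in_itvoo ab; exists q; rewrite in_itv/= in qab.
have lo i : x ord0 i - e < x ord0 i by rewrite gtrBl.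
have hi i : x ord0 i < x ord0 i + e by rewrite ltrDl.
pose q := (\row_i sval (rat_between _ _ (lo i)),
           \row_i sval (rat_between _ _ (hi i))).
have q1 i : x ord0 i - e < (B q).1 ord0 i < x ord0 i.
  by rewrite !mxE; exact: svalP (rat_between _ _ (lo i)).
have q2 i : x ord0 i < (B q).2 ord0 i < x ord0 i + e.
  by rewrite !mxE; exact: svalP (rat_between _ _ (hi i)).
exists q => /=; last first.
  by move=> i; have /andP[_ /ltW->] := q1 i; have /andP[/ltW->] := q2 i.
move=> y yq; apply: xeQ; split=> // i j; rewrite (ord1 i) /ball/= ltr_norml.
have /andP[y1 y2] := yq j; have /andP[q11 q12] := q1 j.
by have /andP[q21 q22] := q2 j; apply/andP; split; lra.
Qed.

Let lebesgue_Rd_sigma_finite : sigma_finite setT lebesgue_Rd.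
Proof.
exists (fun n => box (const_mx (- n%:R), const_mx n%:R)) => [|n]; last first.
  split; first exact: lebesgue_Rd_measurable_box.
  set c := (_, _); rewrite (@le_lt_trans _ _ (box_volume c)%:E) ?ltry//.
  apply: ereal_inf_lbound; exists [set 0%N], (fun=> c); split.
    by move=> x xc; exists 0%N.
  by rewrite esum_set1// lee_fin box_volume_ge0.
apply/esym; rewrite -subTset => x _.
exists (Num.trunc (\sum_j `|x ord0 j|)).+1 => // i /=.
rewrite !mxE -ler_norml (le_trans _ (ltW (truncnS_gt _)))//.
by rewrite (bigD1 i)//= lerDl sumr_ge0.
Qed.

HB.instance Definition _ := @Measure_isSigmaFinite.Build _ _ _
  lebesgue_Rd lebesgue_Rd_sigma_finite.

Section restriction.
Variables (Q : set 'rV[R]_d) (oQ : open Q).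

(* Lebesgue measure on Q, as a measure on R^d that ignores the complement of Q:
   Lspaces over it are spaces of functions on R^d modulo equality a.e. in Q. *)
Definition lebesgue_on : set (Leb R d) -> \bar R :=
  mrestr lebesgue_Rd (lebesgue_Rd_measurable_open oQ).

HB.instance Definition _ := Measure.on lebesgue_on.

Let lebesgue_on_sigma_finite : sigma_finite setT lebesgue_on.
Proof.
have [F FT mF] := sigma_finiteT lebesgue_Rd.
exists F => // n; split; first exact: (mF n).1.
rewrite (le_lt_trans _ (mF n).2)//; apply: le_measure; last exact: subIsetl.
- by rewrite inE; apply: measurableI;
    [exact: (mF n).1|exact: lebesgue_Rd_measurable_open].
- by rewrite inE; exact: (mF n).1.
Qed.

HB.instance Definition _ := @Measure_isSigmaFinite.Build _ _ _
  lebesgue_on lebesgue_on_sigma_finite.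
End restriction.

End lebesgue_measure_Rd.

(* The library provides the quotient [LspaceType] as a bare type; we equip it
   with its structure of normed vector space. *)
Section Lspace_normedModType.
Context (d : measure_display) (T : measurableType d) (R : realType).
Variables (mu : {measure set T -> \bar R}) (p : \bar R) (p1 : (1 <= p)%E).
Notation Lfun := (LfunType mu p1).
Notation Lp := (LspaceType mu p1).
Local Open Scope quotient_scope.

HB.instance Definition _ := gen_eqMixin Lp.
HB.instance Definition _ := gen_choiceMixin Lp.

Lemma Lspace_ext (u v : Lp) : u = v %[ae mu] -> u = v.
Proof.
move=> uv; have : (u : {mfun_ mu, T >-> measurableTypeR R}) = v.
  by rewrite -[LHS]reprK -[RHS]reprK; apply/eqmodP/asboolP.
case: u v {uv} => [u [[hu]]] [v [[hv]]] /= uv.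
by rewrite uv in hu *; congr (LebesgueSpace.Pack (LebesgueSpace.Class
  (isFinLebesgue.Build _ _ _ _ _ _ _ _))); exact: Prop_irrelevance.
Qed.

Lemma ae_eq_Lnorm (f g : T -> R) : measurable_fun setT f ->
  measurable_fun setT g -> f = g %[ae mu] ->
  ('N[mu]_p[EFin \o f] = 'N[mu]_p[EFin \o g])%E.
Proof.
move=> mf mg fg; rewrite unlock /Lnorm; case: p p1 => [r r1|_|//].
  congr (_ `^ _)%E; apply: ge0_ae_eq_integral => //=.
  - apply/measurable_EFinP; apply: (measurableT_comp (measurable_powR r)).
    exact: measurableT_comp.
  - apply/measurable_EFinP; apply: (measurableT_comp (measurable_powR r)).
    exact: measurableT_comp.
  - by apply: filterS fg => x fgx _; rewrite fgx.
case: ifPn => // _; apply: eq_ess_sup.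
by apply: filterS fg => x fgx /=; rewrite fgx.
Qed.

Section class.
Variable f : Lfun.

Let f_mfun : {mfun T >-> measurableTypeR R} := MeasurableFun.Pack
  (MeasurableFun.Class (@isMeasurableFun.Build _ _ T (measurableTypeR R) f
    (measurable_funPT f))).

Let c : {mfun_ mu, T >-> measurableTypeR R} := \pi f_mfun.

Let cE : c = f %[ae mu].
Proof.
have /eqmodP/asboolP : repr c = f_mfun %[mod {mfun_ mu, T >-> measurableTypeR R}].
  by rewrite reprK.
by [].
Qed.

Let cfin : finite_norm mu p c.
Proof.
have mc : measurable_fun setT (c : T -> R) := measurable_funPT (repr c).
have mf : measurable_fun setT (f : T -> R) := measurable_funPT f.
by rewrite /finite_norm (ae_eq_Lnorm mc mf cE); exact: Lfunction_finite.
Qed.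

Definition Lspace_class : Lp := LebesgueSpace.Pack (LebesgueSpace.Class
  (isFinLebesgue.Build _ _ _ _ _ p1 c cfin)).

Lemma Lspace_classE : Lspace_class = f %[ae mu].
Proof. exact: cE. Qed.
End class.

Lemma Lspace_Lfun (u : Lp) : (u : T -> R) \in (@hoelder.Lfun _ T R mu p).
Proof.
rewrite inE; apply/andP; split; rewrite inE/=.
  exact: (measurable_funPT (repr (u : {mfun_ mu, T >-> measurableTypeR R}))).
exact: Lebesgue_finite.
Qed.

Definition Lspace_repr (u : Lp) : Lfun := Lfun_Sub p1 (Lspace_Lfun u).

Definition Lspace_zero : Lp := Lspace_class 0.
Definition Lspace_opp (u : Lp) : Lp := Lspace_class (- Lspace_repr u).
Definition Lspace_add (u v : Lp) : Lp :=
  Lspace_class (Lspace_repr u + Lspace_repr v).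
Definition Lspace_scale (a : R) (u : Lp) : Lp :=
  Lspace_class (a *: Lspace_repr u).

Let zeroE : \forall x \ae mu, Lspace_zero x = 0.
Proof. by apply: filterS (Lspace_classE 0) => x /(_ Logic.I). Qed.

Let oppE u : \forall x \ae mu, Lspace_opp u x = - u x.
Proof.
by apply: filterS (Lspace_classE (- Lspace_repr u)) => x /(_ Logic.I).
Qed.

Let addE u v : \forall x \ae mu, Lspace_add u v x = u x + v x.
Proof.
apply: filterS (Lspace_classE (Lspace_repr u + Lspace_repr v)) => x.
by move=> /(_ Logic.I).
Qed.

Let scaleE a u : \forall x \ae mu, Lspace_scale a u x = a * u x.
Proof.
by apply: filterS (Lspace_classE (a *: Lspace_repr u)) => x /(_ Logic.I).
Qed.

Let addA : associative Lspace_add.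
Proof.
move=> u v w; apply: Lspace_ext.
near=> x => _.
rewrite (near (addE u (Lspace_add v w)) x)// (near (addE v w) x)//.
by rewrite (near (addE (Lspace_add u v) w) x)// (near (addE u v) x)// addrA.
Unshelve. all: by end_near. Qed.

Let addC : commutative Lspace_add.
Proof.
move=> u v; apply: Lspace_ext; near=> x => _.
by rewrite (near (addE u v) x)// (near (addE v u) x)// addrC.
Unshelve. all: by end_near. Qed.

Let add0 : left_id Lspace_zero Lspace_add.
Proof.
move=> u; apply: Lspace_ext; near=> x => _.
by rewrite (near (addE Lspace_zero u) x)// (near zeroE x)// add0r.
Unshelve. all: by end_near. Qed.

Let addN : left_inverse Lspace_zero Lspace_opp Lspace_add.
Proof.
move=> u; apply: Lspace_ext; near=> x => _.
rewrite (near (addE (Lspace_opp u) u) x)// (near zeroE x)//.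
by rewrite (near (oppE u) x)// addNr.
Unshelve. all: by end_near. Qed.

HB.instance Definition _ := GRing.isZmodule.Build Lp addA addC add0 addN.

Let scaleA a b u : Lspace_scale a (Lspace_scale b u) = Lspace_scale (a * b) u.
Proof.
apply: Lspace_ext; near=> x => _.
rewrite (near (scaleE a (Lspace_scale b u)) x)// (near (scaleE b u) x)//.
by rewrite (near (scaleE (a * b) u) x)// mulrA.
Unshelve. all: by end_near. Qed.

Let scale1 : left_id 1 Lspace_scale.
Proof.
move=> u; apply: Lspace_ext; near=> x => _.
by rewrite (near (scaleE 1 u) x)// mul1r.
Unshelve. all: by end_near. Qed.

Let scaleDr : right_distributive Lspace_scale +%R.
Proof.
move=> a u v; apply: Lspace_ext; near=> x => _.
rewrite (near (scaleE a (Lspace_add u v)) x)// (near (addE u v) x)//.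
rewrite (near (addE (Lspace_scale a u) (Lspace_scale a v)) x)//.
by rewrite (near (scaleE a u) x)// (near (scaleE a v) x)// mulrDr.
Unshelve. all: by end_near. Qed.

Let scaleDl u : {morph Lspace_scale^~ u : a b / a + b}.
Proof.
move=> a b; apply: Lspace_ext; near=> x => _.
rewrite (near (scaleE (a + b) u) x)//.
rewrite (near (addE (Lspace_scale a u) (Lspace_scale b u)) x)//.
by rewrite (near (scaleE a u) x)// (near (scaleE b u) x)// mulrDl.
Unshelve. all: by end_near. Qed.

HB.instance Definition _ := GRing.Zmodule_isLmodule.Build R Lp
  scaleA scale1 scaleDr scaleDl.

Definition Lspace_norm (u : Lp) : R := fine ('N[mu]_p[EFin \o u])%E.

Let class_norm (f : Lfun) :
  Lspace_norm (Lspace_class f) = fine ('N[mu]_p[EFin \o f])%E.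
Proof.
congr fine; apply: ae_eq_Lnorm.
- exact: (measurable_funPT (Lspace_repr (Lspace_class f))).
- exact: (measurable_funPT f).
- exact: Lspace_classE.
Qed.

Let normD u v : Lspace_norm (u + v) <= Lspace_norm u + Lspace_norm v.
Proof. by rewrite class_norm ler_LnormD. Qed.

Let normZ a u : Lspace_norm (a *: u) = `|a| * Lspace_norm u.
Proof.
rewrite class_norm (LnormZ (Lspace_repr u) a).
by rewrite -(finite_norm_fine (Lspace_repr u)) -EFinM.
Qed.

Let norm_eq0 u : Lspace_norm u = 0 -> u = 0.
Proof.
move=> /(@fine_Lnormr_eq0 _ _ _ _ _ _ (Lspace_repr u)) u0.
apply: Lspace_ext; apply: filterS2 u0 zeroE => x /(_ Logic.I) ux zx _.
exact: etrans ux (esym zx).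
Qed.

HB.instance Definition _ := Lmodule_isNormed.Build R Lp normD normZ norm_eq0.

Lemma Lspace_addE (u v : Lp) : u + v = (fun x => u x + v x) %[ae mu].
Proof. by apply: filterS (addE u v). Qed.

Lemma Lspace_scaleE (a : R) (u : Lp) : a *: u = (fun x => a * u x) %[ae mu].
Proof. by apply: filterS (scaleE a u). Qed.

Lemma Lspace_normE (u : Lp) : `|u|%:E = ('N[mu]_p[EFin \o u])%E.
Proof. exact: (finite_norm_fine (Lspace_repr u)). Qed.

End Lspace_normedModType.

Definition linear_isometric_iso (R : realType) (V W : normedModType R)
    (T : V -> W) : Prop :=
  [/\ linear T, forall u, `|T u| = `|u| & bijective T].

Section duality.
Context (d : measure_display) (X : measurableType d) (R : realType).
Variables (mu : {measure set X -> \bar R}) (p q : \bar R).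
Variables (p1 : (1 <= p)%E) (q1 : (1 <= q)%E).

(* The identification of v in L^q, with q the conjugate exponent of p, with a
   linear functional on L^p. *)
Definition dual_pairing (v : LspaceType mu q1) (u : LspaceType mu p1) : R :=
  \int[mu]_x (v x * u x).

(* The transpose of T is phi |-> phi \o T on the dual of L^p. *)
Definition is_adjoint (T : LspaceType mu p1 -> LspaceType mu p1)
    (S : LspaceType mu q1 -> LspaceType mu q1) : Prop :=
  forall v, dual_pairing (S v) = dual_pairing v \o T.
End duality.

Definition countably_generated (d : measure_display) (X : measurableType d) :
    Prop :=
  exists2 G : set (set X), countable G & @measurable d X = <<s G >>.

Record dynamical_system (R : realType) (dO : measure_display)
    (Omega : measurableType dO) (P : probability Omega R) (d : nat)
    (tau : 'rV[R]_d -> Omega -> Omega) : Prop := {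
  tau_measurable : forall x, measurable_fun setT (tau x) ;
  tau_bijective : forall x, bijective (tau x) ;
  tau0 : tau 0 = id ;
  tauD : forall x y, tau (x + y) = tau x \o tau y ;
  tau_invariant : forall x A, measurable A -> P (tau x @` A) = P A ;
  tau_joint_measurable :
    measurable_fun setT (fun z : Omega * Leb R d => tau z.2 z.1) }.

Section unfolding.
Context (R : realType) (dO : measure_display) (Omega : measurableType dO).
Context (P : probability Omega R) (d : nat).
Context (Q : set 'rV[R]_d) (oQ : open Q) (p : \bar R) (p1 : (1 <= p)%E).

Definition OmegaQ : {measure set (Omega * Leb R d) -> \bar R} :=
  (P \x lebesgue_on oQ)%E.

Definition algebraic_tensor (f : Omega * Leb R d -> R) : Prop :=
  exists (n : nat) (phi : 'I_n -> LfunType P p1)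
         (eta : 'I_n -> LfunType (lebesgue_on oQ) p1),
    forall w x, f (w, x) = \sum_(i < n) phi i w * eta i x.

(* (T u)(w, x) = u (tau_(c x) w, x) a.e. for every u in the algebraic tensor
   product. Elements of [LspaceType] are a.e. classes, so the right-hand side is
   written with an arbitrary representative of u of the form
   sum_i phi_i(w) eta_i(x). *)
Definition shifts_tensors (tau : 'rV[R]_d -> Omega -> Omega) (c : R)
    (T : LspaceType OmegaQ p1 -> LspaceType OmegaQ p1) : Prop :=
  forall (f : Omega * Leb R d -> R) (u : LspaceType OmegaQ p1),
    algebraic_tensor f -> u = f %[ae OmegaQ] ->
    T u = (fun z => f (tau (c *: (z.2 : 'rV[R]_d)) z.1, z.2)) %[ae OmegaQ].
End unfolding.

Lemma exponent_ge1 (R : realType) (p : R) : 1 < p -> (1 <= p%:E)%E.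
Proof. by move=> p1; rewrite lee_fin ltW. Qed.

Lemma conjugate_gt1 (R : realType) (p : R) : 1 < p -> 1 < p / (p - 1).
Proof. by move=> p1; rewrite ltr_pdivlMr ?subr_gt0// mul1r gtrBl. Qed.

(* Main.v *)
Require Import Defs.
From HB Require Import structures.
From mathcomp Require Import all_boot all_order all_algebra.
From mathcomp Require Import all_classical all_reals all_analysis.
From mathcomp Require Import measurable_realfun lra.
Set Implicit Arguments.
Unset Strict Implicit.
Unset Printing Implicit Defensive.
Import Order.TTheory GRing.Theory Num.Theory.
Import numFieldNormedType.Exports.
Local Open Scope classical_set_scope.
Local Open Scope ring_scope.

(** The operators are composition with the shears
    Phi_c (w, x) = (tau_(c x) w, x) for c = - 1/eps and c = 1/eps. Dilations of
    R^d multiply the Lebesgue outer measure by |c|^d, hence preserve Caratheodory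
    measurability, so Phi_c is measurable; by Fubini and the invariance of P it
    preserves P x Lebesgue. Composition with Phi_c is thus an isometry of L^p,
    invertible with inverse Phi_(-c), and the change of variables Phi_c in the
    pairing shows that the operators for - 1/eps and 1/eps are adjoint.
    Uniqueness on tensors: two isometries that agree on the indicators of
    rectangles of finite measure agree on indicators of all measurable sets
    (Dynkin), and then everywhere (simple functions, dominated convergence).
    Uniqueness of the adjoint: testing v in L^q against v |v|^(q - 2) in L^p
    gives the q-th power of its norm. *)

(** * Composition with measure-preserving maps *)

Section Lspace_lemmas.
Context (d : measure_display) (X : measurableType d) (R : realType).
Variables (mu : {measure set X -> \bar R}) (p : \bar R) (p1 : (1 <= p)%E).
Local Notation Lp := (LspaceType mu p1).

Lemma measurable_Lspace (u : Lp) : measurable_fun setT (u : X -> R).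
Proof. exact: (measurable_funPT (Lspace_repr u)). Qed.

Lemma Lspace_class_ext (f g : LfunType mu p1) :
  f = g %[ae mu] -> Lspace_class f = Lspace_class g.
Proof.
move=> fg; apply: Lspace_ext; apply: ae_eq_trans (Lspace_classE f) _.
exact: ae_eq_trans fg (ae_eq_sym (Lspace_classE g)).
Qed.

Lemma Lspace_reprK (u : Lp) : Lspace_class (Lspace_repr u) = u.
Proof. by apply: Lspace_ext; exact: Lspace_classE. Qed.

Lemma Lspace_class_linear : linear (@Lspace_class _ _ _ mu p p1).
Proof.
move=> a f g; apply: Lspace_ext.
apply: ae_eq_trans (Lspace_classE _) _; apply: ae_eq_sym.
apply: ae_eq_trans (Lspace_addE _ _) _.
have := Lspace_scaleE a (Lspace_class f).
have := Lspace_classE f; have := Lspace_classE g.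
apply: filterS3 => x /(_ Logic.I) gx /(_ Logic.I) fx /(_ Logic.I) afx _.
by rewrite afx fx gx.
Qed.

Lemma Lspace_class_normE (f : LfunType mu p1) :
  (`|Lspace_class f|%:E = 'N[mu]_p[EFin \o f])%E.
Proof.
rewrite Lspace_normE; apply: ae_eq_Lnorm => //.
- exact: measurable_Lspace.
- exact: Lspace_classE.
Qed.

End Lspace_lemmas.

Section measure_preserving.
Context (d : measure_display) (X : measurableType d) (R : realType).
Variables (mu : {measure set X -> \bar R}) (Phi : X -> X).
Hypothesis mPhi : measurable_fun setT Phi.
Hypothesis muPhi : forall A, measurable A -> mu (Phi @^-1` A) = mu A.

Lemma ae_comp (A : set X) : (\forall x \ae mu, A x) -> \forall x \ae mu, A (Phi x).
Proof.
move=> [N [mN N0 AN]]; exists (Phi @^-1` N); split.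
- by rewrite -[X in measurable X]setTI; exact: mPhi.
- by rewrite muPhi.
- by move=> x Ax; exact: AN.
Qed.

(** The pushforward of [mu] under [Phi] is [mu] itself, so this is the change of variables for
    pushforward measures. *)
Lemma ge0_integral_comp (f : X -> \bar R) : measurable_fun setT f ->
  (forall x, 0 <= f x)%E -> (\int[mu]_x f (Phi x) = \int[mu]_x f x)%E.
Proof.
move=> mf f0.
have := @ge0_integral_pushforward _ _ X X R Phi mPhi mu setT f measurableT mf.
move=> /(_ (fun x _ => f0 x)) <-.
by apply: eq_measure_integral => A mA _; exact: muPhi.
Qed.

(** Positive and negative parts are treated separately, each as a nonnegative function. *)
Lemma integral_comp (f : X -> \bar R) : measurable_fun setT f ->
  (\int[mu]_x f (Phi x) = \int[mu]_x f x)%E.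
Proof.
move=> mf; rewrite (integralE _ _ (f \o Phi)) [RHS]integralE.
rewrite (funepos_comp f Phi) (funeneg_comp f Phi); congr (_ - _)%E.
- exact: (@ge0_integral_comp (f^\+)%E (measurable_funepos mf) (funepos_ge0 f)).
- exact: (@ge0_integral_comp (f^\-)%E (measurable_funeneg mf) (funeneg_ge0 f)).
Qed.

Lemma Lnorm_comp (r : R) (f : X -> R) : measurable_fun setT f ->
  ('N[mu]_r%:E[EFin \o (f \o Phi)] = 'N[mu]_r%:E[EFin \o f])%E.
Proof.
move=> mf; rewrite unlock /Lnorm; apply: (congr1 (fun z => z `^ r^-1)%E).
apply: (@ge0_integral_comp (fun x => `|(f x)%:E| `^ r)%E) => [|x].
  apply: (@measurableT_comp _ _ _ _ _ _ (@poweR R ^~ r)) => //=.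
    exact: measurable_poweR.
  by apply: measurableT_comp => //; exact: measurableT_comp.
exact: poweR_ge0.
Qed.

Variables (p : R) (p1 : (1 <= p%:E)%E).
Local Notation Lp := (LspaceType mu p1).

Lemma Lfun_comp (f : LfunType mu p1) : f \o Phi \in Lfun mu p%:E.
Proof.
rewrite inE; apply/andP; split; rewrite inE/=.
  exact: (measurableT_comp (measurable_funPT f)).
by rewrite /finite_norm Lnorm_comp//; exact: Lfunction_finite.
Qed.

(** The Koopman operator of [Phi]. It composes a chosen representative; by [koopman_ae] any other
    one gives the same class, since preimages of null sets under [Phi] are null. *)
Definition koopman (u : Lp) : Lp :=
  Lspace_class (Lfun_Sub p1 (Lfun_comp (Lspace_repr u))).

Lemma koopmanE (u : Lp) : koopman u = u \o Phi %[ae mu].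
Proof. exact: Lspace_classE. Qed.

Lemma koopman_ae (u : Lp) (f : X -> R) :
  u = f %[ae mu] -> koopman u = f \o Phi %[ae mu].
Proof.
move=> uf; apply: ae_eq_trans (koopmanE u) _.
exact: (ae_comp uf).
Qed.

Lemma koopman_linear : linear koopman.
Proof.
move=> a u v; apply: Lspace_ext.
have auv : a *: u + v = (fun x => a * u x + v x) %[ae mu].
  apply: ae_eq_trans (Lspace_addE _ _) _.
  by apply: filterS (Lspace_scaleE a u) => x + xT => ->.
apply: ae_eq_trans (koopman_ae auv) _; apply: ae_eq_sym.
apply: ae_eq_trans (Lspace_addE _ _) _.
have := Lspace_scaleE a (koopman u).
have := koopmanE u; have := koopmanE v.
by apply: filterS3 => x vx ux aux xT; rewrite aux// ux// vx.
Qed.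

Lemma koopman_norm (u : Lp) : `|koopman u| = `|u|.
Proof.
apply: EFin_inj; rewrite Lspace_class_normE Lspace_normE Lnorm_comp//.
Qed.

End measure_preserving.

Lemma koopman_iso (d : measure_display) (X : measurableType d) (R : realType)
    (mu : {measure set X -> \bar R}) (Phi Psi : X -> X)
    (mPhi : measurable_fun setT Phi) (mPsi : measurable_fun setT Psi)
    (muPhi : forall A, measurable A -> mu (Phi @^-1` A) = mu A)
    (muPsi : forall A, measurable A -> mu (Psi @^-1` A) = mu A)
    (p : R) (p1 : (1 <= p%:E)%E) :
  cancel Phi Psi -> cancel Psi Phi ->
  linear_isometric_iso (koopman mPhi muPhi (p1 := p1)).
Proof.
move=> PhiK PsiK; split; [exact: koopman_linear|exact: koopman_norm|].
exists (koopman mPsi muPsi (p1 := p1)) => u; apply: Lspace_ext.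
  apply: ae_eq_trans (koopman_ae _ _ (koopmanE _ _ u)) _.
  by apply: aeW => x _ /=; rewrite PsiK.
apply: ae_eq_trans (koopman_ae _ _ (koopmanE _ _ u)) _.
by apply: aeW => x _ /=; rewrite PhiK.
Qed.

(** * Density of rectangles in the L^p space of a product *)

Lemma cvg_powR0 (R : realType) (r : R) (a : nat -> R) : 0 < r ->
  (forall n, 0 <= a n) -> a n @[n --> \oo] --> 0 -> a n `^ r @[n --> \oo] --> 0.
Proof.
move=> r0 a0 /cvgrPdist_lt acvg; apply/cvgrPdist_lt => e e0.
(* Once [a n] is below e^(1/r), its r-th power is below e. *)
have er0 : 0 < e `^ r^-1 by exact: powR_gt0.
near=> n; rewrite sub0r normrN ger0_norm ?powR_ge0//.
rewrite -[ltRHS]powRr1 ?ltW// -(@mulVf _ r) ?gt_eqF// powRrM.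
apply: gt0_ltr_powR; rewrite ?nnegrE ?powR_ge0//.
rewrite -[ltLHS]ger0_norm// -normrN -[X in `|X|]sub0r.
by near: n; exact: acvg.
Unshelve. all: by end_near. Qed.

Section Lspace_dominated_convergence.
Context (d : measure_display) (X : measurableType d) (R : realType).
Variables (mu : {measure set X -> \bar R}) (p : R) (p1 : (1 <= p%:E)%E).

Let p_gt0 : 0 < p.
Proof. by move: p1; rewrite lee_fin => /(lt_le_trans ltr01). Qed.

Lemma Lspace_class_powR_norm (f : LfunType mu p1) :
  ((`|Lspace_class f| `^ p)%:E = \int[mu]_x (`|f x| `^ p)%:E)%E.
Proof.
rewrite -poweR_EFin Lspace_class_normE poweR_Lnorm ?gt_eqF//.
Qed.

(** The powers |f_n - f|^p tend to 0 pointwise and are dominated by the integrable (2g)^p, so their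
    integrals tend to 0; a p-th root turns this into convergence in norm. *)
Lemma Lspace_class_dominated_cvg (f_ : nat -> LfunType mu p1)
    (f g : LfunType mu p1) :
  (forall n x, `|f_ n x| <= g x) -> (forall x, f_ n x @[n --> \oo] --> f x) ->
  Lspace_class (f_ n) @[n --> \oo] --> Lspace_class f.
Proof.
move=> fg ff.
have fle x : `|f x| <= g x.
  have /cvg_norm nf := ff x.
  rewrite -(cvg_lim _ nf)//; apply: limr_le; first by apply/cvg_ex; eexists; exact: nf.
  by near=> n; exact: fg.
pose h n x : \bar R := (`|f_ n x - f x| `^ p)%:E.
have mh n : measurable_fun setT (h n).
  apply/measurable_EFinP; apply: (measurableT_comp (measurable_powR p)) => //.
  by apply: measurableT_comp => //; apply: measurable_funB.
have ig : mu.-integrable setT (fun x => (`|(2 *: g) x| `^ p)%:E).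
  apply: Lfun_integrable; first by move: p1; rewrite lee_fin.
  exact: LfunP.
have h0 x : h n x @[n --> \oo] --> 0%E.
  apply/fine_cvgP; split; first by near=> n.
  apply: (@cvg_powR0 _ _ (fun n => `|f_ n x - f x|)) => //.
  by apply/norm_cvg0P/subr_cvg0; exact: ff.
have hg n x : (`|h n x| <= (`|(2 *: g) x| `^ p)%:E)%E.
  rewrite gee0_abs ?lee_fin ?powR_ge0//.
  apply: ge0_ler_powR; rewrite ?nnegrE ?(ltW p_gt0)//.
  rewrite (le_trans (ler_normB _ _))// (le_trans (lerD (fg _ _) (fle _)))//.
  by rewrite (le_trans _ (ler_norm _))// -[leRHS]/(2 * g x); lra.
have [_ _] := @dominated_convergence _ _ _ mu setT measurableT h (cst 0%E) _ mh
  (measurable_cst _) (aeW _ (fun x _ => h0 x)) ig (aeW _ (fun x n _ => hg n x)).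
rewrite integral0 => /fine_cvgP[_ ch].
have normE n : `|Lspace_class (f_ n) - Lspace_class f| =
    fine (\int[mu]_x h n x) `^ p^-1.
  rewrite -[LHS]powRr1// -(@mulfV _ p) ?gt_eqF// powRrM; congr (_ `^ _).
  have -> : Lspace_class (f_ n) - Lspace_class f = Lspace_class (f_ n - f).
    by rewrite -scaleN1r addrC -Lspace_class_linear scaleN1r addrC.
  exact: (congr1 fine (Lspace_class_powR_norm (f_ n - f))).
apply/subr_cvg0/norm_cvg0P; under eq_fun do rewrite normE.
apply: cvg_powR0 => //; first by rewrite invr_gt0.
by move=> n; apply: fine_ge0; apply: integral_ge0 => x _; rewrite lee_fin powR_ge0.
Unshelve. all: by end_near. Qed.
End Lspace_dominated_convergence.

Lemma Lfun_le (d : measure_display) (X : measurableType d) (R : realType)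
    (mu : {measure set X -> \bar R}) (p : R) (f g : X -> R) : 1 <= p ->
  measurable_fun setT f -> g \in Lfun mu p%:E -> (forall x, `|f x| <= `|g x|) ->
  f \in Lfun mu p%:E.
Proof.
move=> p1 mf gL fg; rewrite inE; apply/andP; split; rewrite inE//=.
have p0 : 0 <= p by rewrite (le_trans ler01).
rewrite /finite_norm unlock poweR_lty//=.
have /integrableP[mg goo] := Lfun_integrable p1 gL.
apply: le_lt_trans goo; apply: ge0_le_integral => //.
- apply/measurable_EFinP; apply: (measurableT_comp (measurable_powR p)) => //.
  exact: measurableT_comp.
- exact: measurableT_comp.
- move=> x _; rewrite gee0_abs ?lee_fin ?powR_ge0//.
  by apply: ge0_ler_powR; rewrite ?nnegrE.
Qed.

Lemma indic_Lfun (d : measure_display) (X : measurableType d) (R : realType)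
    (mu : {measure set X -> \bar R}) (p : R) (A : set X) : 1 <= p ->
  measurable A -> (mu A < +oo)%E -> \1_A \in Lfun mu p%:E.
Proof.
move=> p1 mA Aoo; rewrite inE; apply/andP; split; rewrite inE/=.
  exact: measurable_indic.
rewrite /finite_norm unlock poweR_lty//=.
have <- : (\int[mu]_x (\1_A x)%:E = \int[mu]_x (`|\1_A x| `^ p)%:E)%E; last first.
  by rewrite integral_indic ?setIT.
apply: eq_integral => x _; rewrite indicE ger0_norm//.
by case: (x \in A); rewrite ?powR1 ?powR0// gt_eqF// (lt_le_trans ltr01).
Qed.

Section density.
Context (d1 d2 : measure_display) (T1 : measurableType d1)
  (T2 : measurableType d2) (R : realType).
Variables (m1 : {sigma_finite_measure set T1 -> \bar R}).
Variables (m2 : {sigma_finite_measure set T2 -> \bar R}).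
Variables (p : R) (p1 : (1 <= p%:E)%E).
Local Notation mu := (m1 \x m2)%E.
Local Notation Lp := (LspaceType mu p1).

Variable V : set Lp.
Hypothesis V_linear : forall a u v, V u -> V v -> V (a *: u + v).
Hypothesis V_closed : closed V.
Hypothesis V_rectangle : forall A B (u : Lp), measurable A -> measurable B ->
  (m1 A < +oo)%E -> (m2 B < +oo)%E -> u = \1_(A `*` B) %[ae mu] -> V u.

Let p_ge1 : 1 <= p. Proof. by move: p1; rewrite lee_fin. Qed.

(** Transfers [V] from classes to genuine functions, for which pointwise limits and identities
    between indicators make sense. The class does not depend on the proof [fL]. *)
Let W (f : T1 * T2 -> R) :=
  exists fL : f \in Lfun mu p%:E, V (Lspace_class (Lfun_Sub p1 fL)).

Let W_linear a f g : W f -> W g -> W (fun x => a * f x + g x).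
Proof.
move=> [fL Vf] [gL Vg].
have hL : (fun x => a * f x + g x) \in Lfun mu p%:E.
  exact: (LfunP (a *: Lfun_Sub p1 fL + Lfun_Sub p1 gL)).
exists hL; have := V_linear a Vf Vg; rewrite -Lspace_class_linear.
by congr V; apply: Lspace_class_ext; exact: aeW.
Qed.

Let W_dominated (f_ : nat -> T1 * T2 -> R) f g : (forall n, W (f_ n)) ->
  f \in Lfun mu p%:E -> g \in Lfun mu p%:E ->
  (forall n x, `|f_ n x| <= g x) -> (forall x, f_ n x @[n --> \oo] --> f x) -> W f.
Proof.
move=> Wf fL gL fg ff; exists fL.
pose F n := Lfun_Sub p1 (projT1 (cid (Wf n))).
have := @Lspace_class_dominated_cvg _ _ _ mu p p1 F (Lfun_Sub p1 fL)
  (Lfun_Sub p1 gL) fg ff.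
apply: (closed_cvg V) => //; apply: nearW => n.
exact: projT2 (cid (Wf n)).
Qed.

Let W_rectangle A B : measurable A -> measurable B ->
  (m1 A < +oo)%E -> (m2 B < +oo)%E -> W \1_(A `*` B).
Proof.
move=> mA mB Aoo Boo.
have AB : (mu (A `*` B) < +oo)%E.
  by rewrite product_measure1E// lte_mul_pinfty// ge0_fin_numE.
exists (indic_Lfun p_ge1 (measurableX mA mB) AB).
exact/V_rectangle/Lspace_classE.
Qed.

(** Dynkin induction on C inside the fixed rectangle E = A x B. Since E has finite measure,
    complements are differences from the indicator of E, and countable disjoint unions are limits
    dominated by that indicator. *)
Let W_indic A B C : measurable A -> measurable B ->
  (m1 A < +oo)%E -> (m2 B < +oo)%E -> measurable C -> W \1_(C `&` A `*` B).
Proof.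
move=> mA mB Aoo Boo mC.
have AB : (mu (A `*` B) < +oo)%E.
  by rewrite product_measure1E// lte_mul_pinfty// ge0_fin_numE.
have WAB := W_rectangle mA mB Aoo Boo.
(* Zero arises as (-1) f + f. *)
have W0 : W \1_set0.
  have := W_linear (-1) WAB WAB; congr W; apply/funext => x.
  by rewrite mulN1r addNr indic0.
have mE : measurable (A `*` B) by exact: measurableX.
have WE A' B' : measurable A' -> measurable B' -> W \1_(A' `*` B' `&` A `*` B).
  move=> mA' mB'; rewrite -setXI; apply: W_rectangle.
  - exact: measurableI.
  - exact: measurableI.
  - by rewrite (le_lt_trans _ Aoo)// le_measure ?inE//; exact: measurableI.
  - by rewrite (le_lt_trans _ Boo)// le_measure ?inE//; exact: measurableI.
(* The rectangle becomes an opaque set E, as the induction concerns C alone. *)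
move: (A `*` B) AB WAB mE WE => E AB WAB mE WE.
have sE D : D `&` E `<=` E by apply: subIset; right.
move: C mC.
rewrite [measurable]measurable_prod_measurableType.
apply: (@dynkin_induction _ (T1 * T2)%type
  [set A `*` B | A in @measurable _ T1 & B in @measurable _ T2]).
- exact: measurable_prod_measurableType.
- move=> _ _ [A1 mA1 [A2 mA2 <-]] [B1 mB1 [B2 mB2 <-]].
  exists (A1 `&` B1); first exact: measurableI.
  by exists (A2 `&` B2); [exact: measurableI|rewrite setXI].
- by rewrite setTI.
- by move=> _ [A' mA' [B' mB' <-]]; exact: WE.
- move=> S mS WS; have := W_linear (-1) WS WAB; congr W; apply/funext => x.
  rewrite mulN1r !indicE !in_setI in_setC.
  by case: (x \in S); case: (x \in E); rewrite /= ?addNr ?oppr0 ?addr0 ?add0r.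
- move=> F mF tF WF.
  have WU n : W \1_(\big[setU/set0]_(i < n) F i `&` E).
    elim: n => [|n IH]; first by rewrite big_ord0 set0I.
    have := W_linear 1 IH (WF n); congr W; apply/funext => x.
    rewrite big_ord_recr/= mul1r !indicE !in_setI in_setU.
    (* Disjointness makes the indicator of the enlarged union the sum of the two indicators. *)
    have : ~ (x \in \big[setU/set0]_(i < n) F i /\ x \in F n).
      rewrite !inE -bigcup_mkord => -[[i /= iltn Fix] Fnx].
      have := tF i n Logic.I Logic.I (ex_intro _ x (conj Fix Fnx)).
      by move=> in'; rewrite in' ltnn in iltn.
    by case: (x \in \big[_/_]_(_ < _) _); case: (x \in F n); case: (x \in E) => //=;
      rewrite ?addr0 ?add0r// => -[].
  apply: (W_dominated (g := \1_E) WU).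
  + apply: indic_Lfun => //.
      by apply: measurableI; [exact: bigcup_measurable|exact: mE].
    apply: le_lt_trans AB; apply: le_measure; rewrite ?inE.
    * by apply: measurableI; [exact: bigcup_measurable|exact: mE].
    * exact: mE.
    * exact: sE.
  + exact: indic_Lfun.
  + move=> n x; rewrite !indicE in_setI ger0_norm// ler_nat.
    by case: (x \in E); rewrite ?andbF//; case: (_ \in _).
  (* The sequence is eventually constant: if x lies in [F k], the partial unions over i < n contain
     x from n = k + 1 on; otherwise none of them does. *)
  + move=> x; have [[k _ Fkx]|nFx] := pselect ((\bigcup_k F k) x).
      apply: (@cvg_near_cst _ _ _ _ _ _ _).
      exists k.+1 => // n /= kn; rewrite !indicE !in_setI; congr ((_ && _)%:R).
      rewrite mem_set; last by rewrite -bigcup_mkord; exists k.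
      by rewrite mem_set//; exists k.
    rewrite (_ : (fun n => _) = cst (\1_(\bigcup_k F k `&` E) x)).
      exact: cvg_cst.
    apply/funext => n; rewrite !indicE !in_setI; congr ((_ && _)%:R).
    rewrite memNset; last first.
      by rewrite -bigcup_mkord => -[i _ Fix]; apply: nFx; exists i.
    by rewrite memNset.
Qed.

Import HBNNSimple.

(** The approximating simple functions are cut off by finite-measure rectangles [F n] x [G n] that
    exhaust the product. The truncations stay below g and converge to it pointwise. *)
Let W_ge0 g : g \in Lfun mu p%:E -> (forall x, 0 <= g x) -> W g.
Proof.
move=> gL g0.
have mg : measurable_fun setT (EFin \o g).
  by apply/measurable_EFinP; exact: (measurable_funPT (Lfun_Sub p1 gL)).
have Eg0 x : [set: T1 * T2] x -> (0 <= (EFin \o g) x)%E by rewrite lee_fin.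
have /sigma_finiteP[F [TF ndF Foo]] := sigma_finiteT m1.
have /sigma_finiteP[G [TG ndG Goo]] := sigma_finiteT m2.
pose s := nnsfun_approx measurableT mg.
apply: (W_dominated (f_ := fun n x => s n x * \1_(F n `*` G n) x) _ gL gL).
- move=> n.
  (* The truncated simple function is a finite sum over its values of multiples of indicators
     covered by [W_indic]. *)
  have W_sum (r : seq R) :
      W (fun x => \sum_(y <- r) y * \1_(s n @^-1` [set y] `&` F n `*` G n) x).
    have [mFn Fnoo] := Foo n; have [mGn Gnoo] := Goo n.
    have WI C : measurable C -> W \1_(C `&` F n `*` G n) by exact: W_indic.
    elim: r => [|y r IH].
      have := W_linear (-1) (WI _ measurableT) (WI _ measurableT).
      by congr W; apply/funext => x; rewrite big_nil mulN1r addNr.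
    have ms : measurable (s n @^-1` [set y]) by exact: measurable_sfunP.
    have := W_linear y (WI _ ms) IH.
    by congr W; apply/funext => x; rewrite big_cons.
  have := W_sum (finmap.enum_fset (fset_set (range (s n)))).
  congr W; apply/funext => x.
  rewrite (fimfunE (s n) x) fsbig_finite// big_distrl/=.
  by apply: eq_bigr => y _; rewrite indicI/= mulrA.
- move=> n x; rewrite ger0_norm ?mulr_ge0//.
  have sg : s n x <= g x.
    by rewrite -lee_fin /s nnsfun_approxE; exact: (le_approx n Eg0).
  rewrite indicE; case: (_ \in _); rewrite ?mulr1 ?mulr0//.
- move=> x; have [/= n0 _ Fx] : (\bigcup_i F i) x.1 by rewrite -TF.
  have [/= n1 _ Gx] : (\bigcup_i G i) x.2 by rewrite -TG.
  have /fine_cvgP[_ sx] := cvg_nnsfun_approx measurableT mg Eg0 (x := x) Logic.I.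
  (* Both exhaustions are nondecreasing, so beyond [maxn n0 n1] the cut-off equals 1 at x. *)
  apply: cvg_trans sx; apply: near_eq_cvg; exists (maxn n0 n1) => // n /=.
  rewrite geq_max => /andP[n0n n1n]; rewrite indicE mem_set ?mulr1//; split => /=.
    by have /subsetPset := ndF _ _ n0n; apply.
  by have /subsetPset := ndG _ _ n1n; apply.
Qed.

(** Both u^+ and u^- are bounded by |u|, hence in L^p, and u = -u^- + u^+. This is the density of
    rectangles in the form of an induction principle. *)
Lemma Lspace_prod_ind (u : Lp) : V u.
Proof.
have uL := Lspace_Lfun u.
have mu_ := measurable_Lspace u.
have uE x : (u : T1 * T2 -> R)^\+ x + (u : T1 * T2 -> R)^\- x = `|u x|.
  exact: (congr1 (fun f => f x) (funrposDneg u)).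
have Wp : W (u : T1 * T2 -> R)^\+.
  apply: W_ge0 => //; apply: Lfun_le uL _ => //; first exact: measurable_funrpos.
  by move=> x; rewrite -uE ger0_norm// lerDl.
have Wn : W (u : T1 * T2 -> R)^\-.
  apply: W_ge0 => //; apply: Lfun_le uL _ => //; first exact: measurable_funrneg.
  by move=> x; rewrite -uE ger0_norm// lerDr.
have [uL' ] := W_linear (-1) Wn Wp; congr V; apply: Lspace_ext.
apply: ae_eq_trans (Lspace_classE _) _; apply: aeW => x _.
rewrite /= mulN1r addrC; exact: (congr1 (fun f => f x) (funrposBneg u)).
Qed.

End density.

(** * The pairing of L^q with L^p *)

Section pairing.
Context (d : measure_display) (X : measurableType d) (R : realType).
Variables (mu : {measure set X -> \bar R}) (p q : R).
Variables (p1 : (1 <= p%:E)%E) (q1 : (1 <= q%:E)%E).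
Hypothesis pq : p^-1 + q^-1 = 1.
Local Notation Lp := (LspaceType mu p1).
Local Notation Lq := (LspaceType mu q1).

Let p_gt0 : 0 < p. Proof. by move: p1; rewrite lee_fin => /(lt_le_trans ltr01). Qed.
Let q_gt0 : 0 < q. Proof. by move: q1; rewrite lee_fin => /(lt_le_trans ltr01). Qed.
(** With this identity |w|^(q-1) belongs to L^p whenever w belongs to L^q. *)
Let qp : (q - 1) * p = q.
Proof.
have : p * q * (p^-1 + q^-1) = q + p.
  by rewrite mulrDr mulrAC divff ?gt_eqF// mul1r mulfK ?gt_eqF.
by rewrite pq mulr1 mulrBl mul1r mulrC => ->; rewrite addrK.
Qed.

Lemma pairing_integrable (v : Lq) (u : Lp) :
  mu.-integrable setT (EFin \o (fun x => v x * u x)).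
Proof.
apply/Lfun1_integrable; rewrite inE; apply/andP; split; rewrite inE/=.
  by apply: measurable_funM; exact: measurable_Lspace.
apply: le_lt_trans
  (hoelder mu (measurable_Lspace v) (measurable_Lspace u) q_gt0 p_gt0 _) _.
  by rewrite addrC.
by rewrite -!Lspace_normE -EFinM ltry.
Qed.

Lemma dual_pairingB (v w : Lq) (u : Lp) :
  dual_pairing (v - w) u = dual_pairing v u - dual_pairing w u.
Proof.
rewrite /dual_pairing -RintegralB//; try exact: pairing_integrable.
apply: (congr1 fine); apply: ae_eq_integral => //.
- by apply/measurable_EFinP; apply: measurable_funM; exact: measurable_Lspace.
- apply/measurable_EFinP; apply: measurable_funB;
  by apply: measurable_funM; exact: measurable_Lspace.
have := Lspace_addE v (- w); have := Lspace_scaleE (-1) w.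
rewrite scaleN1r; apply: filterS2 => x wx vwx xT.
by rewrite vwx// wx// mulN1r mulrBl.
Qed.

(* For q < 2 the power takes a junk value where w vanishes, but there the
   factor [w x] is 0. *)
Let conjugate (w : Lq) x : R := w x * `|w x| `^ (q - 2).

Let conjugate_norm (w : Lq) x : `|conjugate w x| `^ p = `|w x| `^ q.
Proof.
have q10 : q - 1 != 0.
  apply/eqP => q10; move: qp; rewrite q10 mul0r => /esym/eqP.
  by rewrite gt_eqF.
rewrite /conjugate normrM (ger0_norm (powR_ge0 _ _)).
have [->|wx0] := eqVneq (w x) 0.
  by rewrite normr0 mul0r !powR0 ?gt_eqF.
rewrite -[X in X * _]powRr1// -powRD; last by rewrite normr_eq0 wx0 implybT.
by rewrite -powRrM (_ : 1 + (q - 2) = q - 1) ?qp//; lra.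
Qed.

Let conjugate_mul (w : Lq) x : w x * conjugate w x = `|w x| `^ q.
Proof.
rewrite /conjugate mulrA -expr2 -real_normK ?num_real//.
have [->|wx0] := eqVneq (w x) 0.
  by rewrite normr0 expr0n mul0r !powR0 ?gt_eqF.
rewrite -powR_mulrn// -powRD; last by rewrite normr_eq0 wx0 implybT.
by congr (_ `^ _); lra.
Qed.

Lemma dual_pairing_inj (v w : Lq) :
  (dual_pairing v : Lp -> R) = dual_pairing w -> v = w.
Proof.
move=> vw; apply/subr0_eq; set z := v - w.
have mz : measurable_fun setT (z : X -> R) := measurable_Lspace z.
have mc : measurable_fun setT (conjugate z).
  apply: measurable_funM => //; apply: (measurableT_comp (measurable_powR _)).
  exact: measurableT_comp.
(* Its p-th power is |z|^q, which is integrable. *)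
have cL : conjugate z \in Lfun mu p%:E.
  rewrite inE; apply/andP; split; rewrite inE//= /finite_norm unlock poweR_lty//=.
  under eq_integral do rewrite conjugate_norm.
  by rewrite -(Lspace_class_powR_norm (Lspace_repr z)) ltry.
have : dual_pairing z (Lspace_class (Lfun_Sub p1 cL)) = 0.
  by rewrite dual_pairingB vw subrr.
(* The vanishing pairing equals the q-th power of the norm of z, which forces z = 0. *)
rewrite /dual_pairing (_ : Rintegral _ _ _ = `|z| `^ q).
  by move=> /powR_eq0_eq0 /normr0_eq0.
rewrite -[in RHS](Lspace_reprK z).
rewrite -[RHS]/(fine (_%:E)) Lspace_class_powR_norm; congr fine.
apply: ae_eq_integral => //.
- by apply/measurable_EFinP; apply: measurable_funM => //; exact: measurable_Lspace.
- apply/measurable_EFinP; apply: (measurableT_comp (measurable_powR _)).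
  exact: measurableT_comp.
have := Lspace_classE (Lfun_Sub p1 cL); apply: filterS => x cx xT.
by rewrite cx//; exact: (congr1 EFin (conjugate_mul z x)).
Qed.

(** Substituting [Phi] in the integral of (v o Psi) u turns it into the integral of (v o Psi o Phi)
    (u o Phi), and Psi o Phi is the identity. *)
Lemma dual_pairing_koopman (Phi Psi : X -> X)
    (mPhi : measurable_fun setT Phi) (mPsi : measurable_fun setT Psi)
    (muPhi : forall A, measurable A -> mu (Phi @^-1` A) = mu A)
    (muPsi : forall A, measurable A -> mu (Psi @^-1` A) = mu A)
    (v : Lq) (u : Lp) : cancel Phi Psi ->
  dual_pairing (koopman mPsi muPsi v) u = dual_pairing v (koopman mPhi muPhi u).
Proof.
move=> PhiK; have mL := measurable_Lspace.
rewrite /dual_pairing /Rintegral.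
rewrite -(@integral_comp _ _ _ _ _ mPhi muPhi).
congr fine; apply: ae_eq_integral => //.
- apply/measurable_EFinP; apply: (@measurableT_comp _ _ _ _ _ _
    (fun x => koopman mPsi muPsi v x * u x) _ Phi _ mPhi).
  by apply: measurable_funM; exact: mL.
- by apply/measurable_EFinP; apply: measurable_funM; exact: mL.
have := ae_comp mPhi muPhi (koopmanE mPsi muPsi v).
have := koopmanE mPhi muPhi u; apply: filterS2 => x /= ux vx xT.
by rewrite ux// vx//= PhiK.
apply/measurable_EFinP; apply: measurable_funM; exact: mL.
Qed.

End pairing.

(** * Shears *)

Lemma esumZl (R : realType) (T : choiceType) (I : set T) (a : T -> \bar R)
    (r : R) : 0 < r -> (forall i, 0 <= a i)%E ->
  (\esum_(i in I) (r%:E * a i) = r%:E * \esum_(i in I) a i)%E.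
Proof.
move=> r0 a0; rewrite /esum -ereal_sup_pZl// image_comp; congr ereal_sup.
by apply: eq_imagel => A _ /=; rewrite ge0_mule_fsumr.
Qed.

Section scaling.
Context (R : realType) (d : nat).
Local Notation vec := 'rV[R]_d.

(** Dilating a cover by boxes gives a cover by boxes whose volumes are multiplied by |c|^d. The
    reverse inequality comes from the same lemma for 1/c. *)
Lemma lebesgue_outer_scale (c : R) (A : set vec) : c != 0 ->
  (lebesgue_outer [set c *: x | x in A] <= (`|c| ^+ d)%:E * lebesgue_outer A)%E.
Proof.
move=> c0; have k0 : 0 < `|c| ^+ d by rewrite exprn_gt0// normr_gt0.
rewrite -lee_pdivrMl//; apply: le_ereal_inf_tmp => v [I [b [AI ->]]].
rewrite lee_pdivrMl//.
(* a negative factor exchanges the lower and upper corners *)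
pose sb k := if 0 < c then (c *: (b k).1, c *: (b k).2)
             else (c *: (b k).2, c *: (b k).1).
rewrite -esumZl//; last by move=> k; rewrite lee_fin box_volume_ge0.
apply: ereal_inf_lbound; exists I, sb; split.
  move=> _ [x /AI[k Ik xk] <-]; exists k => // i; have /andP[lx xh] := xk i.
  rewrite /sb; case: ifPn => [cp|]; first by rewrite !mxE !ler_pM2l// lx.
  rewrite lt_neqAle eq_sym c0/= -ltNge => cn.
  by rewrite !mxE !ler_nM2l// xh.
apply: eq_esum => k _; rewrite -EFinM /box_volume.
rewrite (_ : `|c| ^+ d = \prod_(i < d) `|c|); last by rewrite prodr_const card_ord.
rewrite -big_split/=; congr EFin; apply: eq_bigr => i _.
rewrite maxr_pMr ?normr_ge0// mulr0; congr Num.max; rewrite /sb.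
case: ifPn => [cp|]; first by rewrite !mxE -mulrBr gtr0_norm.
by rewrite -leNgt => cn; rewrite !mxE -mulrBr ler0_norm// mulNr -mulrN opprB.
Qed.

Lemma measurable_scale (c : R) : c != 0 ->
  measurable_fun setT ((fun x : vec => c *: x) : Leb R d -> Leb R d).
Proof.
(* Caratheodory's condition for A tested on c X is, up to the factor |c|^d, the
   one for the preimage of A tested on X. *)
move=> c0 _ A mA; rewrite setTI.
have V0 : c^-1 != 0 by rewrite invr_eq0.
have k0 : 0 < `|c^-1| ^+ d by rewrite exprn_gt0// normr_gt0.
pose S (X : set vec) : set vec := [set c *: x | x in X].
(* X is the dilation of [S X] by 1/c. *)
have leS X : (lebesgue_outer X <= (`|c^-1| ^+ d)%:E * lebesgue_outer (S X))%E.
  have := lebesgue_outer_scale (S X) V0; congr (_ <= _)%E; congr lebesgue_outer.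
  apply/seteqP; split => [_ [_ [x Xx <-] <-]|x Xx]; first by rewrite scalerK.
  by exists (c *: x); [exists x|rewrite scalerK].
apply: le_caratheodory_measurable => X.
apply: (le_trans (leeD (leS _) (leS _))).
rewrite -ge0_muleDr; [|exact: outer_measure_ge0..].
rewrite (_ : S _ = S X `&` A); last first.
  apply/seteqP; split => [_ [x [Xx Ax] <-]|_ [[x Xx <-] Ax]].
    by split => //; exists x.
  by exists x.
rewrite (_ : S (_ `&` ~` _) = S X `&` ~` A); last first.
  apply/seteqP; split => [_ [x [Xx Ax] <-]|_ [[x Xx <-] Ax]].
    by split => //; exists x.
  by exists x.
(* The factors |1/c|^d and |c|^d cancel. *)
rewrite -(mA (S X)) -lee_pdivlMl// -exprVn normfV invrK.
exact: lebesgue_outer_scale.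
Qed.
End scaling.

Section shear.
Context (R : realType) (dO : measure_display) (Omega : measurableType dO).
Context (P : probability Omega R) (d : nat) (tau : 'rV[R]_d -> Omega -> Omega).
Hypothesis tau_dyn : dynamical_system P tau.

Lemma tauNK x : cancel (tau x) (tau (- x)).
Proof.
move=> w; have := congr1 (fun f => f w) (tauD tau_dyn (- x) x).
by rewrite /= addNr (tau0 tau_dyn) => <-.
Qed.

(** Invariance is assumed for images; the preimage under tau_x is the image under tau_(-x). *)
Lemma tau_preimage x (A : set Omega) : measurable A -> P (tau x @^-1` A) = P A.
Proof.
move=> mA; rewrite -(tau_invariant tau_dyn (- x) mA); congr (P _).
apply/seteqP; split => [w Aw|_ [w Aw <-]].
  by exists (tau x w) => //; exact: tauNK.
by have := @tauNK (- x) w; rewrite opprK /= => ->.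
Qed.

Definition shear (c : R) (z : Omega * Leb R d) : Omega * Leb R d :=
  (tau (c *: (z.2 : 'rV[R]_d)) z.1, z.2).

Lemma shearK c : cancel (shear c) (shear (- c)).
Proof. by move=> [w x]; rewrite /shear /= scaleNr tauNK. Qed.

(** Joint measurability of tau refers to Lebesgue sets in x, so (w, x) |-> (w, c x) has to be
    measurable for Lebesgue sets and not only for Borel sets; [measurable_scale] provides this. *)
Lemma measurable_shear (c : R) : c != 0 -> measurable_fun setT (shear c).
Proof.
move=> c0; apply/measurable_fun_pair => //=.
have mscale : measurable_fun setT (fun z : Omega * Leb R d =>
    (z.1, (c *: (z.2 : 'rV[R]_d) : Leb R d))).
  apply/measurable_fun_pair => //=.
  exact: measurableT_comp (measurable_scale c0) measurable_snd.
exact: measurableT_comp (tau_joint_measurable tau_dyn) mscale.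
Qed.

(** The shear fixes x, so the section at x of the preimage of A is the preimage under tau_(c x) of
    the section of A, and P gives both the same mass. Hence nu may be Lebesgue measure restricted to
    any open Q. *)
Lemma shear_measure_preserving (c : R)
    (nu : {sigma_finite_measure set (Leb R d) -> \bar R})
    (A : set (Omega * Leb R d)) : c != 0 -> measurable A ->
  ((P \x nu) (shear c @^-1` A) = (P \x nu) A)%E.
Proof.
move=> c0 mA; have ms := measurable_shear c0.
(* In [\x^] the integral over x is the outer one, so P measures the sections at fixed x. *)
have prodE B : measurable B -> ((P \x nu) B = (P \x^ nu) B)%E.
  by apply: product_measure_unique => *; exact: product_measure2E.
have mB : measurable (shear c @^-1` A).
  by rewrite -[X in measurable X]setTI; exact: ms.
rewrite !prodE//; apply: eq_integral => y _ /=.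
rewrite -[RHS](tau_preimage (c *: (y : 'rV[R]_d))); last exact: measurable_ysection.
congr (P _); apply/seteqP; split => w; rewrite /ysection /= !inE//.
Qed.
End shear.

(** * Uniqueness of isometries and the shift operators *)

Lemma isometry_continuous (R : realType) (V W : normedModType R) (T : V -> W) :
  linear T -> (forall u, `|T u| = `|u|) -> continuous T.
Proof.
move=> lT nT u; apply/cvgrPdist_lt => e e0; near=> v.
have -> : T u - T v = T (u - v).
  by have := lT (-1) v u; rewrite !scaleN1r /= [- v + u]addrC [- T v + _]addrC => ->.
by rewrite nT; near: v; exact: cvgr_dist_lt.
Unshelve. all: by end_near. Qed.

(** The set where S and T agree is a closed subspace containing the rectangle indicators, so
    [Lspace_prod_ind] applies. *)
Lemma isometry_prod_unique (d1 d2 : measure_display) (T1 : measurableType d1)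
    (T2 : measurableType d2) (R : realType)
    (m1 : {sigma_finite_measure set T1 -> \bar R})
    (m2 : {sigma_finite_measure set T2 -> \bar R}) (p : R) (p1 : (1 <= p%:E)%E)
    (W : normedModType R) (S T : LspaceType (m1 \x m2)%E p1 -> W) :
  linear S -> linear T -> (forall u, `|S u| = `|u|) -> (forall u, `|T u| = `|u|) ->
  (forall A B (u : LspaceType (m1 \x m2)%E p1), measurable A -> measurable B ->
    (m1 A < +oo)%E -> (m2 B < +oo)%E ->
    u = \1_(A `*` B) %[ae (m1 \x m2)%E] -> S u = T u) ->
  S = T.
Proof.
move=> lS lT nS nT ST; apply/funext.
apply: (@Lspace_prod_ind _ _ _ _ _ _ _ _ _ [set u | S u = T u]) => //=.
  by move=> a u v Su Sv; rewrite lS lT Su Sv.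
have cS := isometry_continuous lS nS; have cT := isometry_continuous lT nT.
(* Closedness: the preimage of the closed set {0} under the continuous map S - T. *)
rewrite (_ : [set u | _] = (fun u => S u - T u) @^-1` [set 0]); last first.
  by apply/seteqP; split => u /=; [move=> ->; rewrite subrr|move/subr0_eq].
apply: closed_comp; last first.
  exact/accessible_closed_set1/hausdorff_accessible/norm_hausdorff.
by move=> u _; exact (cvgB (cS u) (cT u)).
Qed.

Section shift_operators.
Context (R : realType) (dO : measure_display) (Omega : measurableType dO).
Context (P : probability Omega R) (d : nat) (tau : 'rV[R]_d -> Omega -> Omega).
Hypothesis tau_dyn : dynamical_system P tau.
Context (Q : set 'rV[R]_d) (oQ : open Q) (p : R) (p1 : (1 <= p%:E)%E).
Local Notation Lp := (LspaceType (OmegaQ P oQ) p1).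

(** The indicator of a rectangle with sides of finite measure is a tensor with one term, so both
    operators are prescribed on it. *)
Lemma shifts_tensors_unique (c : R) (S T : Lp -> Lp) :
  linear_isometric_iso S -> shifts_tensors tau c S ->
  linear_isometric_iso T -> shifts_tensors tau c T -> S = T.
Proof.
move=> [lS nS _] shS [lT nT _] shT.
apply: (@isometry_prod_unique _ _ _ _ _ P (lebesgue_on oQ)) => //.
move=> A B u mA mB Aoo Boo uAB; apply: Lspace_ext.
have p_ge1 : 1 <= p by move: p1; rewrite lee_fin.
have tAB : algebraic_tensor P oQ p1 \1_(A `*` B).
  exists 1%N, (fun=> Lfun_Sub p1 (indic_Lfun p_ge1 mA Aoo)),
    (fun=> Lfun_Sub p1 (indic_Lfun p_ge1 mB Boo)) => w x.
  rewrite big_ord1 /= !indicE -natrM mulnb; congr ((nat_of_bool _)%:R).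
  by apply/idP/andP; rewrite !inE.
exact: ae_eq_trans (shS _ _ tAB uAB) (ae_eq_sym (shT _ _ tAB uAB)).
Qed.

Let mu_shear (c : R) (c0 : c != 0) (A : set (Omega * Leb R d)) :
  measurable A -> OmegaQ P oQ (shear tau c @^-1` A) = OmegaQ P oQ A.
Proof. exact: shear_measure_preserving. Qed.

Definition shift_operator (c : R) (c0 : c != 0) : Lp -> Lp :=
  koopman (measurable_shear tau_dyn c0) (mu_shear c0) (p1 := p1).

Lemma shift_operator_iso (c : R) (c0 : c != 0) :
  linear_isometric_iso (shift_operator c0).
Proof.
have Nc0 : - c != 0 by rewrite oppr_eq0.
apply: (koopman_iso _ (measurable_shear tau_dyn Nc0) _ (mu_shear Nc0)).
  exact: (shearK tau_dyn).
by move=> z; have := shearK tau_dyn (- c) z; rewrite opprK.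
Qed.

Lemma shift_operator_tensors (c : R) (c0 : c != 0) :
  shifts_tensors tau c (shift_operator c0).
Proof. by move=> f u _ uf; exact: koopman_ae. Qed.

End shift_operators.

Theorem lemma2p5 (R : realType) (dO : measure_display)
    (Omega : measurableType dO) (P : probability Omega R) (d : nat)
    (tau : 'rV[R]_d -> Omega -> Omega)
    (Omega_cg : countably_generated Omega)
    (tau_dyn : dynamical_system P tau)
    (eps : R) (eps_gt0 : 0 < eps) (p : R) (p_gt1 : 1 < p)
    (Q : set 'rV[R]_d) (oQ : open Q) :
  let q := p / (p - 1) in
  let p1 := exponent_ge1 p_gt1 in
  let q1 := exponent_ge1 (conjugate_gt1 p_gt1) in
  let Lp := LspaceType (OmegaQ P oQ) p1 in
  let Lq := LspaceType (OmegaQ P oQ) (q1 : (1 <= q%:E)%E) in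
  exists T : Lp -> Lp,
    unique (fun T' : Lp -> Lp =>
      linear_isometric_iso T' /\ shifts_tensors tau (- eps^-1) T') T /\
    exists S : Lq -> Lq,
      unique (fun S' : Lq -> Lq => is_adjoint T S') S /\
      unique (fun S' : Lq -> Lq =>
        linear_isometric_iso S' /\ shifts_tensors tau eps^-1 S') S.
Proof.
move=> q p1 q1 Lp Lq.
have p0 : 0 < p by rewrite (lt_trans ltr01).
have pq : p^-1 + q^-1 = 1 by rewrite /q invf_div mulrBl divff ?gt_eqF// mul1r subrKC.
have e0 : eps^-1 != 0 by rewrite invr_eq0 gt_eqF.
have Ne0 : - eps^-1 != 0 by rewrite oppr_eq0.
exists (shift_operator tau_dyn (oQ := oQ) (p1 := p1) Ne0); split.
  split; first by split; [exact: shift_operator_iso|exact: shift_operator_tensors].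
  move=> T [isoT shT]; apply: shifts_tensors_unique isoT shT.
    exact: shift_operator_iso.
  exact: shift_operator_tensors.
(* The shear for -1/eps, used as change of variables in the pairing, undoes the shear for 1/eps. *)
have adj : is_adjoint (shift_operator tau_dyn (oQ := oQ) (p1 := p1) Ne0)
    (shift_operator tau_dyn (oQ := oQ) (p1 := q1) e0).
  move=> v; apply/funext => u; apply: dual_pairing_koopman => z.
  by have := shearK tau_dyn (- eps^-1) z; rewrite opprK.
exists (shift_operator tau_dyn (oQ := oQ) (p1 := q1) e0); split.
  split=> // S adjS; apply/funext => v.
  (* Two adjoints send v to elements inducing the same functional on L^p, and the pairing separates
     L^q. *)
  by apply: (dual_pairing_inj (p1 := p1) pq); rewrite adj adjS.
split; first by split; [exact: shift_operator_iso|exact: shift_operator_tensors].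
move=> S [isoS shS]; apply: shifts_tensors_unique isoS shS.
  exact: shift_operator_iso.
exact: shift_operator_tensors.
Qed.
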